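(* Let $\mathcal D$ be a commutative variety of (unordered) algebras, let $X,Y\in\mathcal D$ and let $L:X^*\to Y$ be a language. Define the relation $\equiv_L$ on $|X^*|$ by $u\equiv_L v$ iff $L(x\bullet u\bullet y)=L(x\bullet v\bullet y)$ for all $x,y\in|X^*|$. Then $\equiv_L$ is a congruence on the $\mathcal D$-monoid $X^*$ (an equivalence relation that is a sub-$\mathcal D$-monoid of $X^*\times X^*$), and the quotient map $X^*\to X^*/{\equiv_L}$ is the syntactic $\mathcal D$-monoid of $L$, i.e. $\mathrm{Syn}(L)=X^*/{\equiv_L}$.
   Context: A commutative variety $\mathcal D$ is a variety of $\Sigma$-algebras, $\Sigma$ finitary, such that for all $A,B$ the set $[A,B]$ of homomorphisms is a subalgebra of $B^{|A|}$. Its tensor product $A\otimes B$ represents bimorphisms (maps $|A|\times|B|\to|C|$ that are homomorphisms in each variable), and $I$ is the free algebra on one generator. A $\mathcal D$-monoid is an object $M$ with a monoid structure $(|M|,\bullet,1)$ whose multiplication is a bimorphism; morphisms are homomorphisms preserving $\bullet,1$. $X^*$ is the free $\mathcal D$-monoid on $X$ with multiplication $\bullet$; a language is a morphism $L:X^*\to Y$ in $\mathcal D$. A $\mathcal D$-monoid morphism $e:X^*\to M$ recognizes $L$ if $L=f\circ e$ for some morphism $f:M\to Y$ of $\mathcal D$. An $X$-generated $\mathcal D$-monoid is a surjective $\mathcal D$-monoid morphism $e:X^*\to M$; $e_1\le e_2$ iff $e_1=h\circ e_2$ for a $\mathcal D$-monoid morphism $h$. The syntactic $\mathcal D$-monoid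 $\mathrm{Syn}(L)$ is the (unique up to isomorphism) $X$-generated $\mathcal D$-monoid recognizing $L$ that is $\le$ every $X$-generated $\mathcal D$-monoid recognizing $L$. *)

(* Defs.v *)
From mathcomp Require Import all_boot boolp classical_sets.

Set Implicit Arguments.
Unset Strict Implicit.
Unset Printing Implicit Defensive.

Local Open Scope classical_set_scope.

Record signature := Signature { op_sym : Type; arity : op_sym -> nat }.

Record algebra (S : signature) := Algebra {
  carrier :> Type;
  op : forall o : op_sym S, ('I_(arity o) -> carrier) -> carrier }.

Inductive term (S : signature) : Type :=
| Var of nat
| App (o : op_sym S) of ('I_(arity o) -> term S).

Fixpoint eval (S : signature) (A : algebra S) (v : nat -> A) (t : term S) : A :=
  match t with
  | Var n => v n
  | App o ts => op (fun i => eval v (ts i))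
  end.

Definition satisfies (S : signature) (E : set (term S * term S))
    (A : algebra S) : Prop :=
  forall e, E e -> forall v : nat -> A, eval v e.1 = eval v e.2.

(** A variety is presented by equations between terms in countably many
    variables; its members are the algebras of type [object D]. *)
Record variety := Variety {
  sig :> signature;
  equations : set (term sig * term sig) }.

Record object (D : variety) := Object {
  object_alg :> algebra D;
  object_sat : satisfies (@equations D) object_alg }.

Definition is_hom (S : signature) (A B : algebra S) (f : A -> B) : Prop :=
  forall (o : op_sym S) (a : 'I_(arity o) -> A),
    f (op a) = op (fun i => f (a i)).

Definition is_subalgebra (S : signature) (A : algebra S) (P : set A) : Prop :=
  forall (o : op_sym S) (a : 'I_(arity o) -> A),
    (forall i, P (a i)) -> P (op a).

Definition power_algebra (S : signature) (T : Type) (B : algebra S) :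
    algebra S :=
  @Algebra S (T -> B) (fun o a t => op (fun i => a i t)).

Definition commutative_variety (D : variety) : Prop :=
  forall A B : object D,
    is_subalgebra (A := power_algebra A B) [set f : A -> B | is_hom f].

Definition is_bimorphism (S : signature) (A B C : algebra S)
    (f : A -> B -> C) : Prop :=
  (forall a, is_hom (f a)) /\ (forall b, is_hom (fun a => f a b)).

Lemma eval_hom (S : signature) (A B : algebra S) (f : A -> B) :
  is_hom f -> forall (v : nat -> A) t, f (eval v t) = eval (f \o v) t.
Proof.
move=> fH v; elim=> [//|o ts IH] /=.
by rewrite fH; congr op; apply/funext => i; rewrite IH.
Qed.

Record dmonoid (D : variety) := DMonoid {
  dmon_obj :> object D;
  dmul : dmon_obj -> dmon_obj -> dmon_obj;
  dunit : dmon_obj;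
  dmulA : associative dmul;
  dmul1l : left_id dunit dmul;
  dmul1r : right_id dunit dmul;
  dmul_bimorphism : is_bimorphism dmul }.

Arguments dunit {D} d.

Declare Scope dmonoid_scope.
Delimit Scope dmonoid_scope with DM.
Local Open Scope dmonoid_scope.
Notation "x • y" := (dmul x y) (at level 40, left associativity) : dmonoid_scope.

Definition is_dmon_hom (D : variety) (M N : dmonoid D) (f : M -> N) : Prop :=
  [/\ is_hom f, f (dunit M) = dunit N & forall x y, f (x • y) = f x • f y].

Definition is_subdmonoid (D : variety) (M : dmonoid D) (P : set M) : Prop :=
  [/\ is_subalgebra P, P (dunit M) & forall x y, P x -> P y -> P (x • y)].

Definition is_free_dmonoid (D : variety) (X : object D) (F : dmonoid D)
    (eta : X -> F) : Prop :=
  is_hom eta /\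
  forall (M : dmonoid D) (f : X -> M), is_hom f ->
    exists! g : F -> M, is_dmon_hom g /\ g \o eta = f.

Lemma pair_ext (T U : Type) (p q : T * U) : p.1 = q.1 -> p.2 = q.2 -> p = q.
Proof. by case: p q => [? ?] [? ?] /= -> ->. Qed.

Section Product.
Variables (D : variety) (M N : dmonoid D).

Definition prod_algebra : algebra D :=
  @Algebra D (M * N)%type
    (fun o a => (op (fun i => (a i).1), op (fun i => (a i).2))).

Lemma prod_sat : satisfies (@equations D) prod_algebra.
Proof.
move=> e Ee v.
have h1 : @is_hom D prod_algebra M fst by [].
have h2 : @is_hom D prod_algebra N snd by [].
apply: pair_ext.
- exact: (etrans (eval_hom h1 v _)
    (etrans (object_sat Ee _) (esym (eval_hom h1 v _)))).
- exact: (etrans (eval_hom h2 v _)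
    (etrans (object_sat Ee _) (esym (eval_hom h2 v _)))).
Qed.

Definition prod_object : object D := Object prod_sat.

Definition prod_mul (x y : prod_object) : prod_object :=
  (x.1 • y.1, x.2 • y.2).

Definition prod_one : prod_object := (dunit M, dunit N).

Lemma prod_mulA : associative prod_mul.
Proof. by move=> x y z; rewrite /prod_mul /= !dmulA. Qed.

Lemma prod_mul1l : left_id prod_one prod_mul.
Proof. by case=> x y; rewrite /prod_mul /= !dmul1l. Qed.

Lemma prod_mul1r : right_id prod_one prod_mul.
Proof. by case=> x y; rewrite /prod_mul /= !dmul1r. Qed.

Lemma prod_bimorphism : is_bimorphism prod_mul.
Proof.
have [lM rM] := @dmul_bimorphism D M; have [lN rN] := @dmul_bimorphism D N.
split=> x o a; apply: pair_ext;
  [exact: lM | exact: lN | exact: rM | exact: rN].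
Qed.

Definition prod_dmonoid : dmonoid D :=
  DMonoid prod_mulA prod_mul1l prod_mul1r prod_bimorphism.

End Product.

Definition is_equivalence (T : Type) (R : T -> T -> Prop) : Prop :=
  [/\ forall x, R x x, forall x y, R x y -> R y x &
      forall x y z, R x y -> R y z -> R x z].

Definition is_congruence (D : variety) (M : dmonoid D) (R : M -> M -> Prop) :
    Prop :=
  is_equivalence R /\
  is_subdmonoid (M := prod_dmonoid M M) [set p : M * M | R p.1 p.2].

(** The elements of the quotient are the equivalence classes [[set y | R x y]];
    its operations are computed on chosen representatives, and [cls_hom] and
    [cls_mul] show that for a congruence the choice does not matter. *)
Definition quot (T : Type) (R : T -> T -> Prop) : Type :=
  {C : set T | exists x, C = [set y | R x y]}.

Definition cls (T : Type) (R : T -> T -> Prop) (x : T) : quot R :=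
  exist _ [set y | R x y] (ex_intro _ x erefl).

Definition repr (T : Type) (R : T -> T -> Prop) (q : quot R) : T :=
  projT1 (cid (proj2_sig q)).

Lemma reprK (T : Type) (R : T -> T -> Prop) (q : quot R) : cls R (repr q) = q.
Proof.
by case: q => C Cx; apply: eq_exist; rewrite /repr; case: cid => x /= e.
Qed.

Lemma cls_eq (T : Type) (R : T -> T -> Prop) (x y : T) :
  is_equivalence R -> (cls R x = cls R y <-> R x y).
Proof.
case=> Rr Rs Rt; split=> [[] e|xy].
  suff: [set z | R x z] y by [].
  by rewrite e; exact: Rr.
apply: eq_exist; apply/seteqP; split=> z /= h.
- exact: Rt (Rs _ _ xy) h.
- exact: Rt xy h.
Qed.

Section Quotient.
Variables (D : variety) (M : dmonoid D) (R : M -> M -> Prop).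
Hypothesis cong : is_congruence R.

Definition quot_algebra : algebra D :=
  @Algebra D (quot R) (fun o q => cls R (op (fun i => repr (q i)))).

Lemma repr_cls x : R (repr (cls R x)) x.
Proof. by apply/(cls_eq _ _ cong.1); rewrite reprK. Qed.

Lemma cls_hom : @is_hom D M quot_algebra (cls R).
Proof.
move=> o a; apply/(cls_eq _ _ cong.1).
have [[_ Rs _] [Ro _ _]] := cong; apply: Rs.
by apply: (Ro o (fun i => (repr (cls R (a i)), a i))) => i; exact: repr_cls.
Qed.

Lemma quot_sat : satisfies (@equations D) quot_algebra.
Proof.
move=> e Ee v.
have -> : v = cls R \o (fun n => repr (v n)).
  by apply/funext => n /=; rewrite reprK.
by rewrite -!(eval_hom cls_hom) (object_sat Ee).
Qed.

Definition quot_object : object D := Object quot_sat.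

Definition quot_mul (p q : quot_object) : quot_object :=
  cls R (repr p • repr q).

Definition quot_one : quot_object := cls R (dunit M).

Lemma cls_mul x y : cls R (x • y) = quot_mul (cls R x) (cls R y).
Proof.
apply/(cls_eq _ _ cong.1).
have [[_ Rs _] [_ _ Rm]] := cong; apply: Rs.
exact: (Rm (_, _) (_, _) (repr_cls x) (repr_cls y)).
Qed.

Lemma quot_mulA : associative quot_mul.
Proof.
by move=> p q r; rewrite -(reprK p) -(reprK q) -(reprK r) -!cls_mul dmulA.
Qed.

Lemma quot_mul1l : left_id quot_one quot_mul.
Proof. by move=> p; rewrite -(reprK p) -cls_mul dmul1l. Qed.

Lemma quot_mul1r : right_id quot_one quot_mul.
Proof. by move=> p; rewrite -(reprK p) -cls_mul dmul1r. Qed.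

Lemma quot_bimorphism : is_bimorphism quot_mul.
Proof.
have [lM rM] := @dmul_bimorphism D M.
split=> p o a; rewrite -[p]reprK.
- have -> : op a = cls R (op (fun i => repr (a i))) by [].
  rewrite -cls_mul lM cls_hom.
  by congr op; apply/funext => i /=; rewrite cls_mul !reprK.
- have -> : op a = cls R (op (fun i => repr (a i))) by [].
  rewrite -cls_mul rM cls_hom.
  by congr op; apply/funext => i /=; rewrite cls_mul !reprK.
Qed.

Definition quot_dmonoid : dmonoid D :=
  DMonoid quot_mulA quot_mul1l quot_mul1r quot_bimorphism.

Definition quot_proj : M -> quot_dmonoid := cls R.

End Quotient.

(** From here on [F] stands for the free D-monoid X^*. *)

Definition synt_rel (D : variety) (F : dmonoid D) (Y : object D) (L : F -> Y)
    (u v : F) : Prop :=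
  forall x y : F, L (x • u • y) = L (x • v • y).

Definition recognizes (D : variety) (F : dmonoid D) (Y : object D) (L : F -> Y)
    (M : dmonoid D) (e : F -> M) : Prop :=
  exists2 f : M -> Y, is_hom f & L = f \o e.

Definition is_generated (D : variety) (F M : dmonoid D) (e : F -> M) : Prop :=
  is_dmon_hom e /\ forall m, exists u, e u = m.

Definition gen_le (D : variety) (F M1 M2 : dmonoid D)
    (e1 : F -> M1) (e2 : F -> M2) : Prop :=
  exists2 h : M2 -> M1, is_dmon_hom h & e1 = h \o e2.

Definition is_syntactic (D : variety) (F : dmonoid D) (Y : object D)
    (L : F -> Y) (M : dmonoid D) (e : F -> M) : Prop :=
  [/\ is_generated e, recognizes L e &
      forall (N : dmonoid D) (e' : F -> N),
        is_generated e' -> recognizes L e' -> gen_le e e'].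

Lemma syntactic_unique (D : variety) (F : dmonoid D) (Y : object D)
    (L : F -> Y) (M1 M2 : dmonoid D) (e1 : F -> M1) (e2 : F -> M2) :
  is_syntactic L e1 -> is_syntactic L e2 ->
  exists (h : M1 -> M2) (k : M2 -> M1),
    [/\ is_dmon_hom h, is_dmon_hom k, cancel h k, cancel k h & h \o e1 = e2].
Proof.
move=> [g1 r1 m1] [g2 r2 m2].
have [k kH kE] := m1 _ _ g2 r2; have [h hH hE] := m2 _ _ g1 r1.
exists h, k; split=> // x.
- have [u <-] := g1.2 x.
  by rewrite -[h (e1 u)]/((h \o e1) u) -hE -[k (e2 u)]/((k \o e2) u) -kE.
- have [u <-] := g2.2 x.
  by rewrite -[k (e2 u)]/((k \o e2) u) -kE -[h (e1 u)]/((h \o e1) u) -hE.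
Qed.

Arguments is_syntactic {D F Y} L M e.

(* Main.v *)
(** The maps [u |-> L (x • u • y)] are homomorphisms because multiplication is a
    bimorphism, and [synt_rel L] is the intersection of their kernels, hence a
    congruence. Taking [x = y = 1] shows that [L] factors through the quotient.
    If [L = f \o e] with [e] a surjective morphism of D-monoids, then
    [L (x • u • y) = f (e x • e u • e y)] depends on [u] only through [e u], so
    the kernel of [e] is contained in [synt_rel L] and the quotient map factors
    through [e]. *)

From mathcomp Require Import all_boot boolp.
Require Import Defs.

Set Implicit Arguments.
Unset Strict Implicit.
Unset Printing Implicit Defensive.

Local Open Scope dmonoid_scope.

(** The factor is [g] after a chosen section [s] of [e]; the kernel condition makes its values
    independent of the choice. *)
Lemma hom_factor (S : signature) (A B C : algebra S) (e : A -> B) (g : A -> C) :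
  is_hom e -> (forall b, exists a, e a = b) -> is_hom g ->
  (forall u v, e u = e v -> g u = g v) ->
  exists2 h : B -> C, is_hom h & g = h \o e.
Proof.
move=> eH e_surj gH ker_le.
have [s sK] := choice e_surj.
exists (g \o s); last by apply/funext => a /=; apply: ker_le; rewrite sK.
move=> o b /=; rewrite -gH; apply: ker_le.
by rewrite sK eH; congr op; apply/funext => i; rewrite sK.
Qed.

(** The factor of the underlying algebras preserves unit and product because [e] and [g] do and [e]
    is surjective. *)
Lemma dmon_hom_factor (D : variety) (M N P : dmonoid D)
    (e : M -> N) (g : M -> P) :
  is_generated e -> is_dmon_hom g -> (forall u v, e u = e v -> g u = g v) ->
  exists2 h : N -> P, is_dmon_hom h & g = h \o e.
Proof.
move=> [[eH e1 eM] e_surj] [gH g1 gM] ker_le.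
have [h hH gE] := hom_factor eH e_surj gH ker_le; exists h => //.
have heE u : h (e u) = g u by rewrite gE.
split=> //; first by rewrite -e1 heE.
move=> n n'; have [u <-] := e_surj n; have [v <-] := e_surj n'.
by rewrite -eM !heE gM.
Qed.

Lemma context_hom (D : variety) (M : dmonoid D) (Y : object D) (L : M -> Y)
    (x y : M) :
  is_hom L -> is_hom (fun u : M => L (x • u • y)).
Proof.
move=> L_hom o a; have [lM rM] := @dmul_bimorphism D M.
by rewrite lM rM L_hom.
Qed.

Lemma synt_rel_congruence (D : variety) (M : dmonoid D) (Y : object D)
    (L : M -> Y) :
  is_hom L -> is_congruence (synt_rel L).
Proof.
move=> L_hom; split; split=> //=.
- by move=> u v uv x y.
- by move=> u v w uv vw x y; rewrite uv.
- move=> o a Ra x y /=; rewrite !(context_hom x y L_hom).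
  by congr op; apply/funext => i; exact: Ra.
- move=> [u u'] [v v'] /= Ru Rv x y.
  (* First [u] is replaced in the context [x], [v • y], then [v] in the context [x • u'], [y]. *)
  by rewrite !dmulA -(dmulA (x • u)) Ru dmulA Rv.
Qed.

Lemma synt_rel_eq (D : variety) (M : dmonoid D) (Y : object D) (L : M -> Y)
    (u v : M) :
  synt_rel L u v -> L u = L v.
Proof. by move=> /(_ (dunit M) (dunit M)); rewrite !dmul1l !dmul1r. Qed.

Lemma recognizes_synt_rel (D : variety) (M N : dmonoid D) (Y : object D)
    (L : M -> Y) (e : M -> N) (u v : M) :
  is_dmon_hom e -> recognizes L e -> e u = e v -> synt_rel L u v.
Proof. by move=> [_ _ eM] [f _ ->] euv x y /=; rewrite !eM euv. Qed.

Lemma quot_proj_generated (D : variety) (M : dmonoid D) (R : M -> M -> Prop)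
    (cong : is_congruence R) :
  is_generated (quot_proj cong).
Proof.
split; last by move=> q; exists (repr q); exact: reprK.
by split=> //; [exact: cls_hom | exact: cls_mul].
Qed.

Theorem theorem3p13 (D : variety) (D_comm : commutative_variety D)
  (X Y : object D) (Xstar : dmonoid D) (eta : X -> Xstar)
  (Xstar_free : is_free_dmonoid eta)
  (L : Xstar -> Y) (L_hom : is_hom L) :
  exists cong : is_congruence (synt_rel L),
    is_syntactic L (quot_dmonoid cong) (quot_proj cong).
Proof.
have cong := synt_rel_congruence L_hom; exists cong.
have gen := quot_proj_generated cong; split=> //.
(* [Y] carries no multiplication, so [L] is factored as a homomorphism of algebras only. *)
- apply: hom_factor => //; [by case: gen => [[]] | exact: gen.2 |].
  by move=> u v /(cls_eq _ _ cong.1); exact: synt_rel_eq.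
- move=> N e e_gen e_rec; apply: (dmon_hom_factor e_gen gen.1) => u v euv.
  by apply/(cls_eq _ _ cong.1); exact: recognizes_synt_rel e_gen.1 e_rec euv.
Qed.
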